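(* Let $\widetilde Q$ be any quandle-valued invariant of links (assigning to each oriented, possibly virtual, link $L$ a quandle $\widetilde Q(L)$, well defined up to isomorphism) such that, for every link $L$, the translation-commutative quotient of $\widetilde Q(L)$ is $Q_{\mathrm{tc}}(L)$ (up to isomorphism). If $L$ and $L'$ are links with $\widetilde Q(L)\cong\widetilde Q(L')$, then both of the following hold. (a) $L$ and $L'$ have the same number of components. (b) The components of $L$ and $L'$ can be indexed so that $L=K_1\cup\dots\cup K_\mu$, $L'=K'_1\cup\dots\cup K'_\mu$, and there are $\epsilon_1,\dots,\epsilon_\mu\in\{-1,1\}$ such that $\ell_{j/i}(K_i,K_j)=\epsilon_i\,\ell_{j/i}(K'_i,K'_j)$ for all $i\neq j\in\{1,\dots,\mu\}$.
   Context: Quandles. A quandle is a set $Q$ with a binary operation $\triangleright$ such that: $x\triangleright x=x$ for all $x$; for each $y\in Q$ the map $\beta_y(x)=x\triangleright y$ is a bijection $Q\to Q$ (a translation); and $(w\triangleright x)\triangleright y=(w\triangleright y)\triangleright(x\triangleright y)$ for all $w,x,y$. A quandle map is a function $f$ with $f(x\triangleright y)=f(x)\triangleright f(y)$; a bijective quandle map is an isomorphism. A quandle is translation-commutative if the group generated by its translations is commutative, equivalently $(x\triangleright y)\triangleright z=(x\triangleright z)\triangleright y$ for all $x,y,z$. The translation-commutative quotient $Q_{\mathrm{tc}}$ of a quandle $Q$ is the quandle presented by a generator $x_q$ for each $q\in Q$, relations $x_{p\triangleright q}=x_p\triangleright x_q$ for all $p,q\in Q$, and relations $(x_p\triangleright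 x_q)\triangleright x_r=(x_p\triangleright x_r)\triangleright x_q$ for all $p,q,r\in Q$. Links. A link diagram $D$ is an oriented virtual link diagram in $\mathbb R^2$: it is obtained from a finite union of $\mu$ oriented piecewise smooth closed curves in general position (finitely many, transverse, double-point intersections and self-intersections, called crossings), each crossing being designated classical (with over/under information) or virtual. At each classical crossing a short piece of the underpassing segment is removed on each side of the crossing; virtual crossings are circled and nothing is removed there. This cuts the curves into arcs; $A(D)$ is the set of arcs. Two diagrams are equivalent if related by a finite sequence of detour moves (affecting only virtual crossings) and classical Reidemeister moves; an equivalence class is an (oriented, virtual) link $L=K_1\cup\dots\cup K_\mu$ with components $K_i$ given by the closed curves. Writhe. At a classical crossing $c$, the writhe $w(c)$ is $+1$ if, looking along the direction of the overpassing segment, the underpassing segment crosses from right to left, and $-1$ if it crosses from left to right. For $i\ne j$, let $C_{j/i}(D)$ be the set of classical crossings at which $K_j$ passes over $K_i$; the linking number of $K_j$ over $K_i$ is $\ell_{j/i}(K_i,K_j)=\ell_{j/i}(K_j,K_i)=\sum_{c\in C_{j/i}(D)}w(c)$, a link invariant. Link quandle. If $D$ is a diagram of $L$, $Q(L)$ is the quandle generated by $\{q_a\mid a\in A(D)\}$ subject to the relation $q_{a_3}=q_{a_2}\triangleright q_{a_1}$ at each classical crossing, where $a_1$ is the overpassing arc, and $a_2$ (resp. $a_3$) is the underpassing arc on the right (resp. left) of $a_1$ with respect to the orientation of $a_1$. It is a link invariant up to isomorphism. $Q_{\mathrm{tc}}(L)$ denotes $Q(L)_{\mathrm{tc}}$.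 *)

(* Defs.v *)
From HB Require Import structures.
From mathcomp Require Import all_boot all_order all_algebra all_fingroup.
From mathcomp Require Import generic_quotient.
From mathcomp Require Import all_classical all_reals all_analysis.
Set Implicit Arguments.
Unset Strict Implicit.
Unset Printing Implicit Defensive.
Import Order.TTheory GRing.Theory Num.Theory numFieldNormedType.Exports.
Local Open Scope classical_set_scope.
Local Open Scope ring_scope.
Local Open Scope quotient_scope.

HB.mixin Record isQuandle (Q : Type) := {
  qop : Q -> Q -> Q;
  qop_id : forall x, qop x x = x;
  qop_bij : forall y, bijective (fun x => qop x y);
  qop_dist : forall w x y, qop (qop w x) y = qop (qop w y) (qop x y)
}.

#[short(type="quandleType")]
HB.structure Definition Quandle := {Q of isQuandle Q}.

Notation "x ▷ y" := (qop x y) (at level 40, left associativity) : ring_scope.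

Definition quandle_map (Q Q' : quandleType) (f : Q -> Q') : Prop :=
  forall x y, f (x ▷ y) = f x ▷ f y.

Definition quandle_iso (Q Q' : quandleType) : Prop :=
  exists2 f : Q -> Q', quandle_map f & bijective f.

(* [TOpV t u] stands for the preimage of [t] under the translation by [u]. *)
Inductive qterm (X : Type) : Type :=
| TGen of X
| TOp of qterm X & qterm X
| TOpV of qterm X & qterm X.

HB.instance Definition _ (X : Type) := gen_eqMixin (qterm X).
HB.instance Definition _ (X : Type) := gen_choiceMixin (qterm X).

Section Presentation.
Variables (X : Type) (r : qterm X -> qterm X -> Prop).

Inductive qterm_eq : qterm X -> qterm X -> Prop :=
| QErel t u : r t u -> qterm_eq t u
| QErefl t : qterm_eq t t
| QEsym t u : qterm_eq t u -> qterm_eq u t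
| QEtrans t u v : qterm_eq t u -> qterm_eq u v -> qterm_eq t v
| QEop t t' u u' :
    qterm_eq t t' -> qterm_eq u u' -> qterm_eq (TOp t u) (TOp t' u')
| QEopV t t' u u' :
    qterm_eq t t' -> qterm_eq u u' -> qterm_eq (TOpV t u) (TOpV t' u')
| QEid t : qterm_eq (TOp t t) t
| QEopK t u : qterm_eq (TOpV (TOp t u) u) t
| QEopVK t u : qterm_eq (TOp (TOpV t u) u) t
| QEdist t u v :
    qterm_eq (TOp (TOp t u) v) (TOp (TOp t v) (TOp u v)).

Definition qterm_eqb : rel (qterm X) := fun t u => `[< qterm_eq t u >].

Lemma qterm_eqb_refl : reflexive qterm_eqb.
Proof. by move=> t; apply/asboolP; apply: QErefl. Qed.

Lemma qterm_eqb_sym : symmetric qterm_eqb.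
Proof. by move=> t u; apply/asboolP/asboolP; apply: QEsym. Qed.

Lemma qterm_eqb_trans : transitive qterm_eqb.
Proof.
by move=> u t v /asboolP tu /asboolP uv; apply/asboolP; apply: QEtrans tu uv.
Qed.

Canonical qterm_equiv :=
  EquivRel qterm_eqb qterm_eqb_refl qterm_eqb_sym qterm_eqb_trans.

Definition presented : Type := {eq_quot qterm_equiv}.

Definition presented_class (t : qterm X) : presented :=
  \pi_({eq_quot qterm_equiv}) t.

Definition presented_repr (x : presented) : qterm X :=
  repr (x : {eq_quot qterm_equiv}).

Lemma presented_reprK x : presented_class (presented_repr x) = x.
Proof. exact: reprK. Qed.

Lemma presented_classP t u :
  presented_class t = presented_class u <-> qterm_eq t u.
Proof.
split; first by move/eqmodP/asboolP.
by move=> tu; apply/eqmodP/asboolP.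
Qed.

Lemma presented_classK t :
  qterm_eq (presented_repr (presented_class t)) t.
Proof. by apply/presented_classP; rewrite presented_reprK. Qed.

Definition presented_op (x y : presented) : presented :=
  presented_class (TOp (presented_repr x) (presented_repr y)).

Definition presented_opV (x y : presented) : presented :=
  presented_class (TOpV (presented_repr x) (presented_repr y)).

Lemma presented_op_class t u :
  presented_op (presented_class t) (presented_class u) =
  presented_class (TOp t u).
Proof. by apply/presented_classP; apply: QEop; apply: presented_classK. Qed.

Lemma presented_opV_class t u :
  presented_opV (presented_class t) (presented_class u) =
  presented_class (TOpV t u).
Proof. by apply/presented_classP; apply: QEopV; apply: presented_classK. Qed.

Lemma presented_op_id x : presented_op x x = x.
Proof.
rewrite -(presented_reprK x) presented_op_class.
by apply/presented_classP; apply: QEid.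
Qed.

Lemma presented_op_bij y : bijective (fun x => presented_op x y).
Proof.
exists (fun x => presented_opV x y) => x;
  rewrite -(presented_reprK x) -(presented_reprK y)
          ?(presented_op_class, presented_opV_class);
  by apply/presented_classP; constructor.
Qed.

Lemma presented_op_dist w x y :
  presented_op (presented_op w x) y =
  presented_op (presented_op w y) (presented_op x y).
Proof.
rewrite -(presented_reprK w) -(presented_reprK x) -(presented_reprK y).
by rewrite !presented_op_class; apply/presented_classP; apply: QEdist.
Qed.

HB.instance Definition _ := isQuandle.Build presented
  presented_op_id presented_op_bij presented_op_dist.

End Presentation.

Inductive tc_relation (Q : quandleType) : qterm Q -> qterm Q -> Prop :=
| TCop p q : tc_relation (TGen (p ▷ q)) (TOp (TGen p) (TGen q))
| TCcomm p q s :
    tc_relation (TOp (TOp (TGen p) (TGen q)) (TGen s))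
                (TOp (TOp (TGen p) (TGen s)) (TGen q)).

Definition tc_quotient (Q : quandleType) : quandleType :=
  presented (@tc_relation Q).

Notation plane R := (R * R)%type.

(* [(i, t)] is the point of parameter [t] on the [i]-th closed curve.  Curves
   are 1-periodic; each point of a curve has exactly one parameter in [0, 1). *)
Notation lpoint R mu := ('I_mu * R)%type.

Section Curves.
Variable R : realType.

Definition velocity (g : R -> plane R) (t : R) : plane R :=
  (derive1 (fun s => (g s).1) t, derive1 (fun s => (g s).2) t).

Definition cross_product (u v : plane R) : R := u.1 * v.2 - u.2 * v.1.

Definition smooth (f : R -> R) : Prop := forall n x, derivable (derive1n n f) x 1.

Definition smooth_arc_on (g : R -> plane R) (a b : R) : Prop :=
  exists2 h : R -> plane R,
    smooth (fun t => (h t).1) /\ smooth (fun t => (h t).2) &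
    forall t, a <= t <= b -> g t = h t /\ velocity h t != (0, 0).

Definition piecewise_smooth (g : R -> plane R) : Prop :=
  exists s : seq R,
    [/\ path <%R 0 s, last 0 s = 1 &
        forall k, (k < size s)%N ->
          smooth_arc_on g (nth 0 (0 :: s) k) (nth 0 s k)].

Definition frac (t : R) : R := t - (Num.floor t)%:~R.

Definition canonical_param (t : R) : Prop := 0 <= t < 1.

End Curves.

Section Diagrams.
Variables (R : realType) (mu : nat).

Definition crossing_of (g : 'I_mu -> R -> plane R) (p q : lpoint R mu) : Prop :=
  [/\ canonical_param p.2, canonical_param q.2, p != q &
      g p.1 p.2 = g q.1 q.2].

(* [over p q] holds when [p] and [q] are the two preimages of a classical
   crossing and the strand through [p] passes over the strand through [q];
   the crossings related by [over] in neither order are the virtual ones. *)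
Record diagram := Diagram {
  curve : 'I_mu -> R -> plane R;
  over : lpoint R mu -> lpoint R mu -> Prop;
  curve_closed : forall i t, curve i (t + 1) = curve i t;
  curve_piecewise_smooth : forall i, piecewise_smooth (curve i);
  crossings_finite :
    finite_set [set c : lpoint R mu * lpoint R mu | crossing_of curve c.1 c.2];
  crossings_double : forall p q q',
    crossing_of curve p q -> crossing_of curve p q' -> q = q';
  crossings_derivable : forall p q, crossing_of curve p q ->
    derivable (fun t => (curve p.1 t).1) p.2 1 /\
    derivable (fun t => (curve p.1 t).2) p.2 1;
  crossings_transverse : forall p q, crossing_of curve p q ->
    cross_product (velocity (curve p.1) p.2) (velocity (curve q.1) q.2) != 0;
  over_crossing : forall p q, over p q -> crossing_of curve p q;
  over_asym : forall p q, over p q -> ~ over q p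
}.

Definition crossing (D : diagram) := crossing_of (curve D).

Definition pt (D : diagram) (p : lpoint R mu) : plane R := curve D p.1 p.2.

(* The cross product of the velocities of the overpassing and underpassing
   strands is positive exactly when the latter crosses from right to left. *)
Definition writhe (D : diagram) (p q : lpoint R mu) : int :=
  sgz (cross_product (velocity (curve D p.1) p.2)
                     (velocity (curve D q.1) q.2)).

Definition crossings_over (D : diagram) (j i : 'I_mu) :
    set (lpoint R mu * lpoint R mu) :=
  [set c | [/\ over D c.1 c.2, c.1.1 = j & c.2.1 = i]].

(* The linking number of the j-th component over the i-th one. *)
Definition linking_over (D : diagram) (j i : 'I_mu) : int :=
  \sum_(c \in crossings_over D j i) writhe D c.1 c.2.

Definition underpass (D : diagram) (p : lpoint R mu) : Prop :=
  exists q, over D q (p.1, frac p.2).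

(* The points [p] and [q] are joined by a piece of their common curve that
   contains no underpass. *)
Definition same_arc (D : diagram) (p q : lpoint R mu) : Prop :=
  p.1 = q.1 /\
  exists k : int, forall t : R,
    Num.min (p.2 + k%:~R) q.2 <= t <= Num.max (p.2 + k%:~R) q.2 ->
    ~ underpass D (p.1, t).

Definition arc (D : diagram) : Type :=
  {a : set (lpoint R mu) | exists2 p, ~ underpass D p & a = same_arc D p}.

(* [arc_before D q a]: [a] is the arc that arrives at the underpass [q]. *)
Definition arc_before (D : diagram) (q : lpoint R mu) (a : arc D) : Prop :=
  \forall t \near q.2^'-, sval a (q.1, t).

Definition arc_after (D : diagram) (q : lpoint R mu) (a : arc D) : Prop :=
  \forall t \near q.2^'+, sval a (q.1, t).

Definition arc_on_right (D : diagram) (p q : lpoint R mu) (a : arc D) : Prop :=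
  if 0 < writhe D p q then arc_before q a else arc_after q a.

Definition arc_on_left (D : diagram) (p q : lpoint R mu) (a : arc D) : Prop :=
  if 0 < writhe D p q then arc_after q a else arc_before q a.

Inductive link_relation (D : diagram) : qterm (arc D) -> qterm (arc D) -> Prop :=
| LinkRelation p q a1 a2 a3 :
    over D p q -> sval a1 p -> arc_on_right p q a2 -> arc_on_left p q a3 ->
    link_relation (TGen a3) (TOp (TGen a2) (TGen a1)).

Definition link_quandle (D : diagram) : quandleType :=
  presented (@link_relation D).

(* An ambient isotopy of the plane carries [D] to [D'], up to the numbering and
   the parametrizations of the closed curves. *)
Definition isotopic (D D' : diagram) : Prop :=
  exists (H G : R -> plane R -> plane R) (s : 'S_mu) (phi : 'I_mu -> R -> R),
    [/\ continuous (fun z : R * plane R => H z.1 z.2),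
        (forall t, [/\ continuous (G t), cancel (H t) (G t) &
                       cancel (G t) (H t)]),
        (forall x, H 0 x = x),
        (forall i, [/\ continuous (phi i), {homo phi i : t u / t < u} &
                       forall t, phi i (t + 1) = phi i t + 1]) &
        (forall i t, curve D' (s i) t = H 1 (curve D i (phi i t))) /\
        (forall i j t u, canonical_param t -> canonical_param u ->
           over D' (s i, t) (s j, u) <->
           over D (i, frac (phi i t)) (j, frac (phi j u)))].

(* A piece of the curve [seg_comp], avoiding a neighbourhood on the left of the
   base point; this is no restriction, since [isotopic] can move base points. *)
Record segment := Segment {
  seg_comp : 'I_mu;
  seg_start : R;
  seg_end : R;
  seg_start_ge0 : 0 <= seg_start;
  seg_start_lt_end : seg_start < seg_end;
  seg_end_lt1 : seg_end < 1
}.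

Definition in_segment (S : segment) (p : lpoint R mu) : Prop :=
  p.1 = seg_comp S /\ seg_start S < p.2 < seg_end S.

Definition in_closed_segment (S : segment) (p : lpoint R mu) : Prop :=
  p.1 = seg_comp S /\ seg_start S <= p.2 <= seg_end S.

Definition agree_off (S : set (lpoint R mu)) (D D' : diagram) : Prop :=
  (forall p, canonical_param p.2 -> ~ S p -> pt D p = pt D' p) /\
  (forall p q, ~ S p -> ~ S q -> over D p q <-> over D' p q).

(* All crossings on the segment are virtual, both before and after the move. *)
Definition detour_move (D D' : diagram) : Prop :=
  exists S : segment,
    [/\ agree_off (in_segment S) D D',
        (forall p q, over D p q -> ~ in_segment S p /\ ~ in_segment S q) &
        (forall p q, over D' p q -> ~ in_segment S p /\ ~ in_segment S q)].

Definition in_strands n (S : 'I_n -> segment) : set (lpoint R mu) :=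
  [set p | exists k, in_segment (S k) p].

Definition in_closed_strands n (S : 'I_n -> segment) : set (lpoint R mu) :=
  [set p | exists k, in_closed_segment (S k) p].

(* The segments [S k] are the strands of [D] inside the open ball [B], with
   their endpoints on the boundary of [B], away from the crossings. *)
Definition strands_in n (S : 'I_n -> segment) (B : set (plane R))
    (D : diagram) : Prop :=
  [/\ (forall p, canonical_param p.2 -> B (pt D p) <-> in_strands S p),
      (forall p, canonical_param p.2 ->
         closure B (pt D p) <-> in_closed_strands S p) &
      (forall p q, crossing D p q -> closure B (pt D p) -> B (pt D p))].

(* [D] and [D'] differ only in a disk, which meets both of them in [n] strands
   with the same endpoints.  For the norm of the product, balls are squares. *)
Definition differ_in_disk n (S : 'I_n -> segment) (D D' : diagram) : Prop :=
  (forall k l p, in_closed_segment (S k) p -> in_closed_segment (S l) p ->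
     k = l) /\
  agree_off (in_strands S) D D' /\
  exists (c : plane R) (e : R),
    [/\ 0 < e, strands_in S (ball c e) D & strands_in S (ball c e) D'].

Definition no_crossing_in n (S : 'I_n -> segment) (D : diagram) : Prop :=
  forall p q, crossing D p q -> ~ in_strands S p.

(* In the three Reidemeister moves, the prescribed crossings determine the
   pictures in the disk up to a homeomorphism of the disk (for the first two)
   and up to exchanging the two sides of the move (for the third one). *)

Definition reidemeister1 (D D' : diagram) : Prop :=
  exists S : 'I_1 -> segment,
    [/\ differ_in_disk S D D',
        no_crossing_in S D' &
        exists p q : lpoint R mu,
          [/\ over D p q, in_strands S p, in_strands S q &
              forall x y, crossing D x y -> in_strands S x ->
                (x, y) = (p, q) \/ (x, y) = (q, p)]].

Definition reidemeister2 (D D' : diagram) : Prop :=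
  exists S : 'I_2 -> segment,
    [/\ differ_in_disk S D D',
        no_crossing_in S D' &
        exists p q p' q' : lpoint R mu,
          [/\ over D p q /\ over D p' q', p != p',
              in_segment (S ord0) p /\ in_segment (S ord0) p',
              in_segment (S ord_max) q /\ in_segment (S ord_max) q' &
              forall x y, crossing D x y -> in_strands S x ->
                [\/ (x, y) = (p, q), (x, y) = (q, p),
                    (x, y) = (p', q') | (x, y) = (q', p')]]].

Definition three_layers (S : 'I_3 -> segment) (D : diagram) : Prop :=
  (forall x y, crossing D x y -> in_strands S x ->
     exists k l, [/\ k != l, in_segment (S k) x & in_segment (S l) y]) /\
  (forall k l : 'I_3, (k < l)%N ->
     exists p q, [/\ in_segment (S k) p, in_segment (S l) q, over D p q &
       forall x y, crossing D x y -> in_segment (S k) x ->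
         in_segment (S l) y -> (x, y) = (p, q)]).

Definition reidemeister3 (D D' : diagram) : Prop :=
  exists S : 'I_3 -> segment,
    [/\ differ_in_disk S D D', three_layers S D & three_layers S D'].

Inductive link_equiv : diagram -> diagram -> Prop :=
| LErefl D : link_equiv D D
| LEsym D D' : link_equiv D D' -> link_equiv D' D
| LEtrans D D' D'' : link_equiv D D' -> link_equiv D' D'' -> link_equiv D D''
| LEisotopy D D' : isotopic D D' -> link_equiv D D'
| LEdetour D D' : detour_move D D' -> link_equiv D D'
| LEreidemeister1 D D' : reidemeister1 D D' -> link_equiv D D'
| LEreidemeister2 D D' : reidemeister2 D D' -> link_equiv D D'
| LEreidemeister3 D D' : reidemeister3 D D' -> link_equiv D D'.

End Diagrams.

(* Main.v *)
Require Import Defs.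
From HB Require Import structures.
From mathcomp Require Import lra.
From mathcomp Require Import all_boot all_order all_algebra.
From mathcomp Require Import all_classical all_reals all_analysis.
(* Gives back to [arc] and [frac] their meaning for diagrams. *)
Import Defs.
Import Order.TTheory GRing.Theory Num.Theory numFieldNormedType.Exports.
Local Open Scope ring_scope.

(** Both conclusions can be read off [Q_tc(L)], and the hypotheses turn an
    isomorphism between the two given quandles into an isomorphism [f] from
    [Q_tc(L)] to [Q_tc(L')].

    In [Q_tc(L)], translating by an arc of [K_j] depends only on [j], because
    conjugating a translation by another one does not change it.  Going once
    around [K_i] one returns to the same element after having been translated,
    at each underpass, by the component passing over, with the sign of the
    crossing.  So the translations act on the part of [Q_tc(L)] that belongs to
    [K_i] through [Z^mu] modulo the i-th basis vector (a quandle operation is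
    idempotent) and the vector [V_i] of the linking numbers of the [K_j] over
    [K_i]; this is exact, as there are no other relations.  An isomorphism
    preserves these parts, hence permutes the components by some [s], and maps
    the subgroup generated by [V_i] to the one generated by [V'_(s i)].  Two
    generators of a cyclic subgroup of [Z^mu] differ by a sign.

    The proof never computes [Q_tc(L)].  It uses the translation-commutative
    quandle [shift_quandle m], whose elements are pairs of an index [i] and a
    set [A] of vectors of [Z^m], the operation by [(j, B)] moving [A] by the
    j-th basis vector when [j] differs from [i].  There are two halves.
    - [map_monodromy]: if a quandle map from [Q(L)] to a shift quandle sends the
      arcs of each [K_i] to pairs of first component [s i], then going around
      [K_i] shows that some set is invariant under the linking vector
      [total_winding D s i].
    - [model_map]: there is a quandle map from [Q(L)] to [shift_quandle mu] that
      sends the arcs of [K_i] to pairs formed by [i] and a coset of [Z V_i].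
    Applied to the composite of [f] with the model of [L'], they show that [V_i]
    is a multiple of [V'_(s i)] ([tc_map_linking]); the inverse of [f] gives
    the converse. *)

Set Implicit Arguments.
Unset Strict Implicit.
Unset Printing Implicit Defensive.

(** * Presented quandles and translation-commutative quotients *)

Section Quandles.

Lemma qop_inj (Q : quandleType) (y : Q) : injective (qop^~ y).
Proof. exact: bij_inj (qop_bij y). Qed.

Lemma qop_surj (Q : quandleType) (x y : Q) : exists z, z ▷ y = x.
Proof. by have [g _ gK] := qop_bij y; exists (g x). Qed.

Definition qopV (Q : quandleType) (x y : Q) : Q := projT1 (cid (qop_surj x y)).

Lemma qopVK (Q : quandleType) (x y : Q) : qopV x y ▷ y = x.
Proof. exact: projT2 (cid (qop_surj x y)). Qed.

Lemma qopK (Q : quandleType) (x y : Q) : qopV (x ▷ y) y = x.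
Proof. by apply: (@qop_inj _ y); rewrite qopVK. Qed.

Fixpoint qeval (X : Type) (Q : quandleType) (g : X -> Q) (t : qterm X) : Q :=
  match t with
  | TGen x => g x
  | TOp t u => qeval g t ▷ qeval g u
  | TOpV t u => qopV (qeval g t) (qeval g u)
  end.

Definition presented_gen (X : Type) (r : qterm X -> qterm X -> Prop) (x : X) :
  presented r := presented_class r (TGen x).

Lemma presented_qop (X : Type) (r : qterm X -> qterm X -> Prop) t u :
  (presented_class r t : presented r) ▷ presented_class r u =
  presented_class r (TOp t u).
Proof. exact: presented_op_class. Qed.

(** The universal property of a quandle presentation. *)
Lemma presented_lift (X : Type) (r : qterm X -> qterm X -> Prop)
    (Q : quandleType) (g : X -> Q) :
  (forall t u, r t u -> qeval g t = qeval g u) ->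
  exists2 phi : presented r -> Q,
    quandle_map phi & forall x, phi (presented_gen r x) = g x.
Proof.
move=> rg.
have eqg t u : qterm_eq r t u -> qeval g t = qeval g u.
  elim=> {t u} //=.
  - by move=> t u v _ -> _ ->.
  - by move=> t t' u u' _ -> _ ->.
  - by move=> t t' u u' _ -> _ ->.
  - by move=> t; exact: qop_id.
  - by move=> t u; exact: qopK.
  - by move=> t u; exact: qopVK.
  - by move=> t u v; exact: qop_dist.
exists (fun x => qeval g (presented_repr x)) => [x y|x].
  rewrite -[X in presented_repr X](_ : presented_class r
    (TOp (presented_repr x) (presented_repr y)) = _) //.
  exact: eqg (presented_classK _ _).
exact: (eqg _ (TGen x)) (presented_classK _ _).
Qed.

(** A presented quandle is generated by its generators, under the operation and
    its left inverse; the last hypothesis is the closure under the latter. *)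
Lemma presented_ind (X : Type) (r : qterm X -> qterm X -> Prop)
    (P : presented r -> Prop) :
  (forall x, P (presented_gen r x)) ->
  (forall x y, P x -> P y -> P (x ▷ y)) ->
  (forall x y, P (x ▷ y) -> P y -> P x) -> forall x, P x.
Proof.
move=> Pgen Pop PopV x; rewrite -(presented_reprK x).
elim: (presented_repr x) => [y|t Pt u Pu|t Pt u Pu]; first exact: Pgen.
  by rewrite -presented_qop; exact: Pop.
apply: (PopV _ (presented_class r u)) Pu; rewrite presented_qop.
by rewrite (presented_classP r _ t).2 //; exact: QEopVK.
Qed.

Lemma quandle_iso_sym (Q Q' : quandleType) :
  quandle_iso Q Q' -> quandle_iso Q' Q.
Proof.
move=> [f fM [g fK gK]]; exists g; last by exists f.
by move=> x y; rewrite -{1}(gK x) -{1}(gK y) -fM fK.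
Qed.

Lemma quandle_iso_trans (Q Q' Q'' : quandleType) :
  quandle_iso Q Q' -> quandle_iso Q' Q'' -> quandle_iso Q Q''.
Proof.
move=> [f fM fB] [g gM gB]; exists (g \o f); last exact: bij_comp.
by move=> x y /=; rewrite fM gM.
Qed.

Definition tc_gen (Q : quandleType) (q : Q) : tc_quotient Q :=
  presented_gen (@tc_relation Q) q.

Lemma tc_gen_map (Q : quandleType) : quandle_map (@tc_gen Q).
Proof.
move=> p q; rewrite presented_qop; apply/presented_classP/QErel; exact: TCop.
Qed.

Lemma tc_gen_comm (Q : quandleType) (p q s : Q) :
  tc_gen p ▷ tc_gen q ▷ tc_gen s = tc_gen p ▷ tc_gen s ▷ tc_gen q.
Proof.
rewrite /tc_gen /presented_gen (presented_qop _ (TGen p) (TGen q)).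
rewrite (presented_qop _ (TGen p) (TGen s)) !(presented_qop _ (TOp _ _)).
by apply/presented_classP/QErel; exact: TCcomm.
Qed.

Lemma tc_lift (Q Q' : quandleType) (g : Q -> Q') : quandle_map g ->
  (forall p q s, g p ▷ g q ▷ g s = g p ▷ g s ▷ g q) ->
  exists2 phi : tc_quotient Q -> Q',
    quandle_map phi & forall q, phi (tc_gen q) = g q.
Proof.
move=> gM gC; have [|phi phiM phiE] := @presented_lift _ (@tc_relation Q) _ g.
  by move=> _ _ [p q|p q s] /=; [exact: gM|exact: gC].
by exists phi.
Qed.

Lemma tc_quotient_iso (Q Q' : quandleType) :
  quandle_iso Q Q' -> quandle_iso (tc_quotient Q) (tc_quotient Q').
Proof.
have lift (Q1 Q2 : quandleType) (f : Q1 -> Q2) : quandle_map f ->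
    exists2 phi : tc_quotient Q1 -> tc_quotient Q2,
      quandle_map phi & forall q, phi (tc_gen q) = tc_gen (f q).
  move=> fM; apply: (@tc_lift _ _ (fun q => tc_gen (f q))).
    by move=> p q; rewrite fM tc_gen_map.
  by move=> p q s; exact: tc_gen_comm.
have liftK (Q1 Q2 : quandleType) (f : Q1 -> Q2) (g : Q2 -> Q1)
    (phi : tc_quotient Q1 -> tc_quotient Q2)
    (psi : tc_quotient Q2 -> tc_quotient Q1) :
    quandle_map phi -> quandle_map psi ->
    (forall q, phi (tc_gen q) = tc_gen (f q)) ->
    (forall q, psi (tc_gen q) = tc_gen (g q)) -> cancel f g -> cancel phi psi.
  move=> phiM psiM phiE psiE fK; apply: presented_ind.
  - by move=> q; rewrite -/(tc_gen q) phiE psiE fK.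
  - by move=> x y xK yK; rewrite phiM psiM xK yK.
  - move=> x y; rewrite phiM psiM => xyK yK; apply: (@qop_inj _ y).
    by rewrite -{1}yK.
move=> fI; have [f fM [g fK gK]] := fI.
have gM : quandle_map g by move=> x y; rewrite -{1}(gK x) -{1}(gK y) -fM fK.
have [phi phiM phiE] := lift _ _ _ fM.
have [psi psiM psiE] := lift _ _ _ gM.
by exists phi => //; exists psi; [apply: (liftK _ _ f g)|apply: (liftK _ _ g f)].
Qed.

End Quandles.

(** * Shift quandles *)

Section ShiftQuandle.
Variable m : nat.
Implicit Types (n : {ffun 'I_m -> int}) (A : set {ffun 'I_m -> int}).

Definition shift n A : set {ffun 'I_m -> int} := [set x | A (x - n)]%classic.

Lemma shift0 A : shift 0 A = A.
Proof. by apply/seteqP; split => x; rewrite /shift /= subr0. Qed.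

Lemma shiftD n n' A : shift n (shift n' A) = shift (n + n') A.
Proof. by apply/seteqP; split => x; rewrite /shift /= opprD addrA. Qed.

(** Zero for [j = i], since a quandle operation is idempotent. *)
Definition dir (i j : 'I_m) : {ffun 'I_m -> int} :=
  [ffun k => ((j != i) && (k == j))%:Z].

Lemma dirii i : dir i i = 0.
Proof. by apply/ffunP => k; rewrite !ffunE eqxx. Qed.

(** With arbitrary sets of vectors instead of the elements of a quotient group,
    one quandle receives the quotients of [Z^m] by all its subgroups, as sets of
    cosets. *)
Definition shift_quandle : Type := ('I_m * set {ffun 'I_m -> int})%type.

Definition shift_op (x y : shift_quandle) : shift_quandle :=
  (x.1, shift (dir x.1 y.1) x.2).

Lemma shift_op_id x : shift_op x x = x.
Proof. by case: x => i A; rewrite /shift_op dirii shift0. Qed.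

Lemma shift_op_bij y : bijective (fun x => shift_op x y).
Proof.
exists (fun x => (x.1, shift (- dir x.1 y.1) x.2)) => -[i A];
  by rewrite /shift_op /= shiftD ?addNr ?subrr shift0.
Qed.

Lemma shift_op_comm w x y :
  shift_op (shift_op w x) y = shift_op (shift_op w y) x.
Proof. by rewrite /shift_op /= !shiftD addrC. Qed.

Lemma shift_op_dist w x y :
  shift_op (shift_op w x) y = shift_op (shift_op w y) (shift_op x y).
Proof. exact: shift_op_comm. Qed.

HB.instance Definition _ := isQuandle.Build shift_quandle
  shift_op_id shift_op_bij shift_op_dist.

Lemma qop_shift (x y : shift_quandle) :
  x ▷ y = (x.1, shift (dir x.1 y.1) x.2).
Proof. by []. Qed.

Definition cyclic_coset (v a : {ffun 'I_m -> int}) :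
  set {ffun 'I_m -> int} := [set x | exists k : int, x = a + v *~ k]%classic.

Lemma shift_coset v a n : shift n (cyclic_coset v a) = cyclic_coset v (a + n).
Proof.
apply/seteqP; split => x [k]; rewrite /shift /=.
  by move/(canRL (subrK n)) => ->; exists k; rewrite addrAC.
by move=> ->; exists k; rewrite addrAC addrK.
Qed.

Lemma cyclic_cosetD v a : cyclic_coset v (a + v) = cyclic_coset v a.
Proof.
apply/seteqP; split => x [k ->].
  by exists (1 + k); rewrite mulrzDr mulr1z addrA.
by exists (k - 1); rewrite -addrA -{2}(mulr1z v) -mulrzDr [1 + _]addrC subrK.
Qed.

(** The stabilizer of a coset of a subgroup is this subgroup. *)
Lemma cyclic_coset_inv v a n : shift n (cyclic_coset v a) = cyclic_coset v a ->
  exists k : int, n = v *~ k.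
Proof.
move=> e; have : cyclic_coset v a (a + n).
  by rewrite -e shift_coset; exists 0; rewrite mulr0z addr0.
by case=> k /addrI ->; exists k.
Qed.

End ShiftQuandle.

(** * Fractional parts and finite sets of reals *)

Section RealLine.
Variable R : realType.

Lemma frac_itv (t : R) : 0 <= frac t < 1.
Proof.
have /andP[h1 h2] := Num.Theory.floor_itv t; rewrite /frac.
by rewrite subr_ge0 h1 ltrBlDl -(intrD _ _ 1) h2.
Qed.

Lemma frac_eq (t : R) (k : int) : 0 <= t - k%:~R < 1 -> frac t = t - k%:~R.
Proof.
rewrite subr_ge0 ltrBlDl => /andP[h1 h2].
rewrite /frac (@Num.Theory.floor_def _ _ k) //.
by rewrite h1 intrD.
Qed.

Lemma frac_id (t : R) : 0 <= t < 1 -> frac t = t.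
Proof. by move=> h; rewrite (@frac_eq _ 0) subr0. Qed.

Lemma fracDz (t : R) (k : int) : frac (t + k%:~R) = frac t.
Proof.
rewrite (@frac_eq _ (k + Num.floor t)).
  by rewrite /frac intrD opprD addrA addrK.
by rewrite intrD opprD addrA addrK; exact: frac_itv.
Qed.

Lemma between3 (a b c t : R) : Num.min a c <= t <= Num.max a c ->
  Num.min a b <= t <= Num.max a b \/ Num.min b c <= t <= Num.max b c.
Proof.
rewrite !ge_min !le_max => /andP[/orP h1 /orP h2].
have [tb|/ltW bt] := leP t b; rewrite ?tb ?bt ?orbT ?andbT /=.
  by case: h1 => ->; rewrite ?orbT; auto.
by case: h2 => ->; rewrite ?orbT; auto.
Qed.

Lemma count_lt (T : eqType) (p q : pred T) (s : seq T) (u : T) :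
  subpred p q -> u \in s -> q u -> ~~ p u -> (count p s < count q s)%N.
Proof.
move=> pq us qu pu; elim: s us => //= v s IH; rewrite inE => /orP[/eqP <-|us].
  by rewrite qu (negPf pu) add0n add1n ltnS; exact: sub_count.
rewrite -addnS leq_add ?IH //; case: (boolP (p v)) => // /pq ->//.
Qed.

Lemma seq_gap (s : seq R) (x : R) :
  exists2 e : R, 0 < e & forall u, u \in s -> x - e <= u <= x + e -> u = x.
Proof.
elim: s => [|v s [e e0 IH]]; first by exists 1.
have [->|vx] := eqVneq v x.
  exists e => // u; rewrite inE => /orP[/eqP//|]; exact: IH.
exists (Num.min e (`|v - x| / 2)).
  by rewrite lt_min e0 divr_gt0 // normr_gt0 subr_eq0.
move=> u; rewrite inE => /orP[/eqP ->|us].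
  rewrite -ler_distl => h; have : `|v - x| <= `|v - x| / 2.
    by apply: le_trans h _; rewrite ge_min lexx orbT.
  have : 0 < `|v - x| by rewrite normr_gt0 subr_eq0.
  lra.
move=> /andP[h1 h2]; apply: IH => //; apply/andP; split.
  by apply: le_trans h1; rewrite lerD2l lerN2 ge_min lexx.
by apply: le_trans h2 _; rewrite lerD2l ge_min lexx.
Qed.

(** Induction along an interval that meets a finite list [U]: a property moves
    across a piece that avoids [U], and across a piece that contains exactly one
    element of [U].  Any element of [U] in the interval, with a small piece
    around it, leaves two intervals that contain fewer elements of [U]. *)
Lemma finite_walk (U : seq R) (P : R -> Prop) (a b : R) :
  (forall x y, a <= x <= y -> y <= b ->
     (forall u, u \in U -> ~~ (x <= u <= y)) -> P x -> P y) ->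
  (forall x u y, a <= x < u -> u < y <= b -> u \in U ->
     (forall v, v \in U -> x <= v <= y -> v = u) -> P x -> P y) ->
  a <= b -> a \notin U -> b \notin U -> P a -> P b.
Proof.
pose n a b := count (fun u => a <= u <= b) U.
have [k] := ubnP (n a b); elim: k a b => // k IH a b nk Pcst Pjump ab aU bU Pa.
have [/hasP[u uU /andP[au ub]]|/hasPn Uab] :=
    boolP (has (fun u => a <= u <= b) U);
  last by apply: (Pcst a) => //; rewrite lexx.
have {}au : a < u by rewrite lt_neqAle au andbT; apply: contraNneq aU => ->.
have {}ub : u < b by rewrite lt_neqAle ub andbT; apply: contraNneq bU => <-.
have [e0 e00 gap] := seq_gap U u.
pose e := Num.min e0 (Num.min (u - a) (b - u)).
have e_gt0 : 0 < e by rewrite !lt_min e00 !subr_gt0 au ub.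
have ee0 : e <= e0 by rewrite ge_min lexx.
have eua : e <= u - a by rewrite !ge_min lexx orbT.
have ebu : e <= b - u by rewrite !ge_min lexx !orbT.
have gapx v : v \in U -> u - e <= v <= u + e -> v = u.
  by move=> vU /andP[h1 h2]; apply: gap => //; apply/andP; split; lra.
have xU : u - e \notin U.
  apply/negP => /gapx; rewrite lexx /= => h; have : u - e = u by apply: h; lra.
  lra.
have yU : u + e \notin U.
  apply/negP => /gapx; rewrite lexx andbT => h; have : u + e = u by apply: h; lra.
  lra.
have smaller c d : a <= c -> d <= b -> ~~ (c <= u <= d) -> (n c d < k)%N.
  move=> ac db ncd; apply: leq_trans (_ : (n a b <= k)%N) => //.
  apply: (@count_lt _ _ _ _ u) => //; last by rewrite !ltW.
  by move=> v /andP[? ?]; apply/andP; split; lra.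
have Px : P (u - e).
  apply: (IH a) => //; try lra.
  - by apply: smaller; rewrite ?lexx //; lra.
  - by move=> x y h1 h2; apply: Pcst => //; lra.
  - by move=> x v y h1 h2; apply: Pjump => //; lra.
have Py : P (u + e).
  by apply: (Pjump (u - e) u) => //; lra.
apply: (IH (u + e)) => //; try lra.
- by apply: smaller; rewrite ?lexx //; lra.
- by move=> x y h1 h2; apply: Pcst => //; lra.
- by move=> x v y h1 h2; apply: Pjump => //; lra.
Qed.

End RealLine.

(** * Arcs and underpasses *)

Section Arcs.
Variables (R : realType) (mu : nat) (D : diagram R mu).
Implicit Types (a b : arc D) (p q : lpoint R mu).

Lemma crossing_sym p q : crossing_of (curve D) p q -> crossing_of (curve D) q p.
Proof. by move=> [h1 h2 h3 h4]; split => //; rewrite eq_sym. Qed.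

Lemma over_canonical p q : over D p q -> 0 <= p.2 < 1 /\ 0 <= q.2 < 1.
Proof. by move=> /over_crossing[]. Qed.

Lemma over_inj p p' q : over D p q -> over D p' q -> p = p'.
Proof.
move=> /over_crossing/crossing_sym h /over_crossing/crossing_sym h'.
exact: crossings_double h h'.
Qed.

Lemma underpass_shift i t (k : int) :
  underpass D (i, t + k%:~R) <-> underpass D (i, t).
Proof. by rewrite /underpass /= fracDz. Qed.

(** A crossing is a double point of the diagram: were the overpassing point also
    an underpass, the strand above it would be the one below it. *)
Lemma over_not_underpass p q : over D p q -> ~ underpass D p.
Proof.
move=> pq [r]; have [pc _] := over_canonical pq.
rewrite frac_id // -surjective_pairing => rp.
have /crossing_sym pr := over_crossing rp.
have er := crossings_double (over_crossing pq) pr; subst r.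
exact: over_asym pq rp.
Qed.

Lemma writhe_sign p q : over D p q ->
  writhe D p q = if 0 < writhe D p q then 1 else -1.
Proof.
move=> /over_crossing/crossings_transverse; rewrite /writhe sgz_gt0 => h.
by case: sgzP h => //; rewrite eqxx.
Qed.

Lemma same_arc_refl p : ~ underpass D p -> same_arc D p p.
Proof.
move=> pU; split=> //; exists 0 => t; rewrite addr0 minxx maxxx -eq_le => /eqP <-.
by rewrite -surjective_pairing.
Qed.

Lemma same_arc_sym p q : same_arc D p q -> same_arc D q p.
Proof.
case: p q => [i t] [j u] [/= <- [k h]]; split => //; exists (- k) => v /= hv.
rewrite -(underpass_shift _ _ k); apply: h; move: hv.
by rewrite rmorphN /= ge_min le_max ge_min le_max => /andP[/orP[] h1 /orP[] h2];
   apply/andP; split; rewrite ?ge_min ?le_max; lra.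
Qed.

Lemma same_arc_trans p q r : same_arc D p q -> same_arc D q r -> same_arc D p r.
Proof.
case: p q r => [i t] [j u] [l v] [/= <- [k h]] [/= <- [k' h']].
split => //; exists (k + k') => w /=; rewrite intrD addrA.
case/(between3 (u + k'%:~R)) => hw; last exact: h'.
rewrite -(underpass_shift _ _ (- k')); apply: h; move: hw.
by rewrite rmorphN /= ge_min le_max ge_min le_max => /andP[/orP[] h1 /orP[] h2];
   apply/andP; split; rewrite ?ge_min ?le_max; lra.
Qed.

Lemma arc_mem_eq a p : sval a p -> sval a = same_arc D p.
Proof.
case: a => A [q qU e] /=; rewrite e => qp; apply/seteqP; split => r /=.
  exact/same_arc_trans/same_arc_sym.
exact: same_arc_trans.
Qed.

Lemma arc_uniq a b p : sval a p -> sval b p -> a = b.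
Proof.
move=> /arc_mem_eq ea /arc_mem_eq eb; have := etrans ea (esym eb).
case: a b {ea eb} => [A hA] [B hB] /= e; subst B.
by congr exist; exact: Prop_irrelevance.
Qed.

Lemma arc_inh a : exists p, sval a p.
Proof. by case: a => A [p pU e]; exists p; rewrite /= e; exact: same_arc_refl. Qed.

Lemma arc_ex p : ~ underpass D p -> exists a, sval a p.
Proof.
by move=> pU; exists (exist _ _ (ex_intro2 _ _ p pU erefl)); exact: same_arc_refl.
Qed.

Lemma arc_itv a i (x y : R) : x <= y ->
  (forall t, x <= t <= y -> ~ underpass D (i, t)) ->
  sval a (i, x) <-> sval a (i, y).
Proof.
move=> xy h; have s : same_arc D (i, x) (i, y).
  by split => //; exists 0 => t /=; rewrite addr0 min_l // max_r //; exact: h.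
split => /arc_mem_eq ->; first exact: s.
exact: same_arc_sym.
Qed.

Lemma arc_not_underpass a p : sval a p -> ~ underpass D p.
Proof.
case: p => i x; case: a => A [q qU eA]; rewrite /= eA => -[/= <- [k]] /(_ x).
by apply; rewrite ge_min le_max lexx !orbT.
Qed.

Lemma arc_shift a i (x : R) (k : int) : sval a (i, x) -> sval a (i, x + k%:~R).
Proof.
move=> ax; rewrite (arc_mem_eq ax); split => //; exists k => t /=.
rewrite minxx maxxx -eq_le => /eqP <-; rewrite underpass_shift.
exact: arc_not_underpass ax.
Qed.

Lemma overs_finite :
  finite_set [set c : lpoint R mu * lpoint R mu | over D c.1 c.2]%classic.
Proof. by apply: sub_finite_set (crossings_finite D) => c; exact: over_crossing. Qed.

Lemma overs_seq : exists s : seq (lpoint R mu * lpoint R mu),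
  uniq s /\ forall c, c \in s <-> over D c.1 c.2.
Proof.
have [s e] := (finite_seqP _).1 overs_finite; exists (undup s).
split=> [|c]; first exact: undup_uniq.
rewrite mem_undup; have := congr1 (fun A => A c) e; rewrite /= => ->.
by split.
Qed.

Definition overs : seq (lpoint R mu * lpoint R mu) := projT1 (cid overs_seq).

Lemma overs_uniq : uniq overs.
Proof. exact: (projT2 (cid overs_seq)).1. Qed.

Lemma oversP c : reflect (over D c.1 c.2) (c \in overs).
Proof. by apply: (iffP idP) => /(projT2 (cid overs_seq)).2. Qed.

Lemma linking_overE j i : linking_over D j i =
  \sum_(c <- overs | (c.1.1 == j) && (c.2.1 == i)) writhe D c.1 c.2.
Proof.
rewrite /linking_over -[RHS]big_filter [RHS]fsbig_seq ?filter_uniq ?overs_uniq //.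
apply: eq_fsbigl; apply/seteqP; split => c; rewrite /= mem_filter.
  by move=> [h -> ->]; rewrite !eqxx; apply/oversP.
by move=> /andP[/andP[/eqP ? /eqP ?] /oversP].
Qed.

Definition unders i : seq R := [seq c.2.2 | c <- overs & c.2.1 == i].

Lemma undersP i u : reflect (exists p, over D p (i, u)) (u \in unders i).
Proof.
apply: (iffP mapP) => [[[p [j v]]]|[p pu]].
  by rewrite mem_filter /= => /andP[/eqP -> /oversP ?] ->; exists p.
by exists (p, (i, u)) => //; rewrite mem_filter eqxx; apply/oversP.
Qed.

Lemma unders_itv i u : u \in unders i -> 0 <= u < 1.
Proof. by move=> /undersP[p /over_canonical[]]. Qed.

Lemma underpass_unders i t : underpass D (i, t) <-> frac t \in unders i.
Proof. by split => [?|/undersP]; first exact/undersP. Qed.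

(** Starting just before the base point, the window from [- e] to [1 - e] covers
    one turn of the curve and meets the underpasses exactly at the parameters in
    [unders], with no wrap-around. *)
Lemma unders_below_one i :
  exists2 e : R, 0 < e < 1 & forall u, u \in unders i -> u < 1 - e.
Proof.
have [e e0 gap] := seq_gap (unders i) 1.
exists (Num.min e 2^-1).
  by rewrite lt_min e0 /=; apply/andP; split; rewrite ?gt_min; lra.
move=> u uU; have /andP[u0 u1] := unders_itv uU; rewrite ltNge; apply/negP => h.
have : Num.min e 2^-1 <= e by rewrite ge_min lexx.
by move=> he; have := gap _ uU; lra.
Qed.

End Arcs.

(** * Walking along a component *)

Section LocalArcs.
Variables (R : realType) (mu : nat) (D : diagram R mu).

Lemma near_leftP (u : R) (P : R -> Prop) :
  (\forall t \near (u^'-)%classic, P t) <->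
  exists2 x, x < u & forall t, x < t < u -> P t.
Proof.
split=> [[e /= e0 h]|[x xu h]].
  exists (u - e) => [|t /andP[h1 h2]]; first by rewrite ltrBlDr ltrDl.
  by apply: (h t) => //=; rewrite ltr_distl; lra.
near=> t; apply: h; apply/andP; split; near: t.
  exact: nbhs_left_gt.
exact: nbhs_left_lt.
Unshelve. all: by end_near. Qed.

Lemma near_rightP (u : R) (P : R -> Prop) :
  (\forall t \near (u^'+)%classic, P t) <->
  exists2 y, u < y & forall t, u < t < y -> P t.
Proof.
split=> [[e /= e0 h]|[x xu h]].
  exists (u + e) => [|t /andP[h1 h2]]; first by rewrite ltrDl.
  by apply: (h t) => //=; rewrite ltr_distl; lra.
near=> t; apply: h; apply/andP; split; near: t.
  exact: nbhs_right_gt.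
exact: nbhs_right_lt.
Unshelve. all: by end_near. Qed.

Lemma arc_beforeI (a : arc D) i (x u : R) : x < u ->
  (forall t, x <= t < u -> ~ underpass D (i, t)) -> sval a (i, x) ->
  arc_before (i, u) a.
Proof.
move=> xu h ax; apply/near_leftP; exists x => // t /= /andP[xt tu].
have /(arc_itv a (ltW xt))[+ _] : forall v, x <= v <= t -> ~ underpass D (i, v).
  by move=> v hv; apply: h; lra.
exact.
Qed.

Lemma arc_afterI (a : arc D) i (u y : R) : u < y ->
  (forall t, u < t <= y -> ~ underpass D (i, t)) -> sval a (i, y) ->
  arc_after (i, u) a.
Proof.
move=> uy h ay; apply/near_rightP; exists y => // t /= /andP[ut ty].
have /(arc_itv a (ltW ty))[_] : forall v, t <= v <= y -> ~ underpass D (i, v).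
  by move=> v hv; apply: h; lra.
exact.
Qed.

(** Along one turn of the i-th curve, a property of a parameter and an arc
    propagates from the starting arc to all others if it moves along each arc and
    across each underpass. *)
Lemma arc_walk i (e : R) (P : R -> arc D -> Prop) (a0 : arc D) : 0 < e < 1 ->
  (forall u, u \in unders D i -> u < 1 - e) ->
  (forall x y a, x <= y -> (forall u, u \in unders D i -> ~~ (x <= u <= y)) ->
     P x a -> P y a) ->
  (forall x u y p a b, x < u < y -> over D p (i, u) ->
     (forall v, v \in unders D i -> x <= v <= y -> v = u) ->
     arc_before (i, u) a -> arc_after (i, u) b -> P x a -> P y b) ->
  sval a0 (i, - e) -> P (- e) a0 ->
  forall t a, - e <= t <= 1 - e -> sval a (i, t) -> P t a.
Proof.
move=> e01 eU Pcst Pjump a0e P0 t a /andP[t1 t2] at_.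
have win v : - e <= v <= 1 - e -> underpass D (i, v) <-> v \in unders D i.
  move=> hv; rewrite underpass_unders; have [v0|v0] := ltP v 0.
    rewrite (@frac_eq _ _ (-1)) rmorphN /= ?opprK; last by lra.
    by split=> [/eU|/unders_itv]; lra.
  by rewrite frac_id //; lra.
suff : forall b, sval b (i, t) -> P t b by apply.
apply: (@finite_walk _ (unders D i)
  (fun t => forall b, sval b (i, t) -> P t b) (- e) t) => //.
- move=> x y hx yt hU Px b b_y.
  have b_x : sval b (i, x).
    have xy : x <= y by lra.
    apply/(arc_itv b xy _).2: b_y => v hv vU.
    have vI : - e <= v <= 1 - e by lra.
    by have := hU v ((win v vI).1 vU); rewrite hv.
  by apply: Pcst (Px _ b_x) => //; lra.
- move=> x u y hx hy uU hU Px b b_y; have [p pu] := undersP _ _ _ uU.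
  have [c c_x] : exists c : arc D, sval c (i, x).
    apply: arc_ex => /win xU. have xu : x = u by apply: hU; [apply: xU|]; lra.
    by move: hx; rewrite xu ltxx andbF.
  apply: (Pjump x u y p c b) (Px _ c_x) => //; first by lra.
    apply: arc_beforeI c_x; first by lra.
    move=> v hv /win vU; have vu : v = u by apply: hU; [apply: vU|]; lra.
    by move: hv; rewrite vu ltxx ?andbF.
  apply: arc_afterI b_y; first by lra.
  move=> v hv /win vU; have vu : v = u by apply: hU; [apply: vU|]; lra.
    by move: hv; rewrite vu ltxx ?andbF.
- by apply/negP => /win; move/(_ _)/(arc_not_underpass a0e); apply; lra.
- by apply/negP => /win; move/(_ _)/(arc_not_underpass at_); apply; lra.
- by move=> b /(arc_uniq a0e) <-.
Qed.

End LocalArcs.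

(** * Winding vectors *)

Section Winding.
Variables (R : realType) (mu m : nat) (D : diagram R mu) (s : 'I_mu -> 'I_m).

(** The translation undergone in a shift quandle at an underpass, when [s] gives
    the first components of the arcs of each curve. *)
Definition turn (c : lpoint R mu * lpoint R mu) : {ffun 'I_m -> int} :=
  dir (s c.2.1) (s c.1.1) *~ writhe D c.1 c.2.

Definition winding (i : 'I_mu) (t : R) : {ffun 'I_m -> int} :=
  \sum_(c <- overs D | (c.2.1 == i) && (c.2.2 < t)) turn c.

Definition total_winding (i : 'I_mu) : {ffun 'I_m -> int} :=
  \sum_(c <- overs D | c.2.1 == i) turn c.

Lemma overs_unders c : c \in overs D -> c.2.2 \in unders D c.2.1.
Proof.
by move=> /oversP h; apply/undersP; exists c.1; rewrite -surjective_pairing.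
Qed.

Lemma winding_const i x y : x <= y ->
  (forall u, u \in unders D i -> ~~ (x <= u < y)) -> winding i y = winding i x.
Proof.
move=> xy h; rewrite /winding big_seq_cond [RHS]big_seq_cond; apply: eq_bigl => c.
apply: andb_id2l => /overs_unders cU; apply: andb_id2l => /eqP ci.
have := h c.2.2; rewrite -ci => /(_ cU).
by case: (leP x c.2.2) => //= xc; rewrite ?(lt_le_trans xc xy) // => /negPf.
Qed.

Lemma winding_jump i p x u y : over D p (i, u) -> x <= u < y ->
  (forall v, v \in unders D i -> x <= v <= y -> v = u) ->
  winding i y = winding i x + turn (p, (i, u)).
Proof.
move=> pu /andP[xu uy] h; rewrite /winding big_mkcond [in RHS]big_mkcond.
have c0 : (p, (i, u)) \in overs D by apply/oversP.
rewrite (bigD1_seq _ c0 (overs_uniq D)) [in RHS](bigD1_seq _ c0 (overs_uniq D)) /=.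
rewrite eqxx uy ltNge xu add0r addrC; congr (_ + _).
rewrite big_seq_cond [RHS]big_seq_cond; apply: eq_bigr => c /andP[cD cN].
case: eqP => //= ci; case: (ltP c.2.2 x) => [cx|xc].
  by rewrite (lt_trans (lt_le_trans cx xu) uy).
case: ltP => // cy; case/eqP: cN; case: c cD ci xc cy => q [j v] /= cD ji xv vy.
subst j; have vu : v = u by apply: h; rewrite ?xv ?ltW //; exact: (overs_unders cD).
by subst v; rewrite (over_inj pu (elimT (oversP _ _) cD)).
Qed.

Lemma winding_min i x :
  (forall u, u \in unders D i -> x <= u) -> winding i x = 0.
Proof.
move=> h; rewrite /winding big_seq_cond big1 // => c.
move=> /and3P[/overs_unders cU /eqP ci].
by rewrite ltNge h // -ci.
Qed.

Lemma winding_max i x : (forall u, u \in unders D i -> u < x) ->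
  winding i x = total_winding i.
Proof.
move=> h; rewrite /winding /total_winding big_seq_cond [RHS]big_seq_cond.
apply: eq_bigl => c; case: (boolP (c \in _)) => //= /overs_unders cU.
by case: eqP => //= ci; rewrite h // -ci.
Qed.

Lemma ffunMzE (f : {ffun 'I_m -> int}) (w : int) k : (f *~ w) k = f k *~ w.
Proof. by case: w => n; rewrite /intmul ?ffunE ffunMnE. Qed.

Lemma total_winding_linking i j : injective s -> i != j ->
  total_winding i (s j) = linking_over D j i.
Proof.
move=> sI ij; rewrite linking_overE /total_winding sum_ffunE.
under [RHS]eq_bigl do rewrite andbC.
rewrite [RHS]big_mkcondr; apply: eq_bigr => c /eqP ci.
rewrite ffunMzE ffunE ci !(inj_eq sI) [j == _]eq_sym.
case: (c.1.1 =P j) => [->|_]; last by rewrite andbF mul0rz.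
by rewrite eq_sym ij intz.
Qed.

End Winding.

(** * Maps from the link quandle to shift quandles *)

Section ToShift.
Variables (R : realType) (mu : nat) (D : diagram R mu).

Definition link_gen (a : arc D) : link_quandle D :=
  presented_gen (@link_relation R mu D) a.

Lemma link_gen_over p q (a b c : arc D) : over D p q -> sval c p ->
  arc_before q a -> arc_after q b ->
  if 0 < writhe D p q then link_gen b = link_gen a ▷ link_gen c
  else link_gen a = link_gen b ▷ link_gen c.
Proof.
move=> pq cp ha hb; case: ifP => w;
  rewrite /link_gen /presented_gen presented_qop; apply/presented_classP/QErel;
  by apply: (LinkRelation pq cp); rewrite /arc_on_right /arc_on_left w.
Qed.

(** The defining relation of a crossing in a shift quandle: whatever the sign [w],
    the outgoing arc is the incoming one moved by [w] times the direction of the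
    overpassing arc. *)
Lemma cross_shift m (w : int) (x y z : shift_quandle m) :
  w = (if 0 < w then 1 else -1) ->
  (if 0 < w then y = x ▷ z else x = y ▷ z) <->
  y = (x.1, shift (dir x.1 z.1 *~ w) x.2).
Proof.
case: ifP => _ ->; first by rewrite mulr1z.
rewrite mulrNz mulr1z; case: x y => [i A] [j B]; split => -[-> ->] /=;
  by rewrite ?qop_shift /= shiftD ?addNr ?subrr shift0.
Qed.

Section Walk.
Variables (m : nat) (phi : link_quandle D -> shift_quandle m).

Let g (a : arc D) := phi (link_gen a).

Lemma map_over p q (a b c : arc D) :
  quandle_map phi -> over D p q -> sval c p ->
  arc_before q a -> arc_after q b ->
  g b = ((g a).1, shift (dir (g a).1 (g c).1 *~ writhe D p q) (g a).2).
Proof.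
move=> phiM pq cp ha hb; apply/(cross_shift _ _ _ (writhe_sign pq)).
have := link_gen_over pq cp ha hb.
by case: ifP => _ e; rewrite /g -phiM e.
Qed.

Lemma arc_in_window i (e : R) (a : arc D) p :
  0 < e < 1 -> sval a p -> p.1 = i ->
  exists2 t, - e <= t <= 1 - e & sval a (i, t).
Proof.
case: p => j t e01 ap /= ji; subst j.
have := @frac_itv _ t; have := arc_shift (- Num.floor t) ap.
rewrite rmorphN /= -/(frac t); set f := frac t => af f01.
have [fe|fe] := leP f (1 - e); first by exists f => //; lra.
exists (f + (-1)%:~R); first by rewrite rmorphN /=; lra.
exact: arc_shift.
Qed.

Lemma cut_arc i (e : R) :
  0 < e < 1 -> (forall u, u \in unders D i -> u < 1 - e) ->
  exists2 a : arc D, sval a (i, - e) & sval a (i, 1 - e).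
Proof.
move=> e01 eU; have [|a ae] := @arc_ex _ _ D (i, - e).
  rewrite underpass_unders (@frac_eq _ _ (-1)) rmorphN /= ?opprK; last by lra.
  by move/eU; lra.
by exists a => //; rewrite addrC; exact: (arc_shift 1).
Qed.

(** The operation of a shift quandle keeps the first component, so that it is the
    same for all the arcs of a curve. *)
Lemma map_component : quandle_map phi -> exists s : 'I_mu -> 'I_m,
  forall a p, sval a p -> (g a).1 = s p.1.
Proof.
move=> phiM; suff /boolp.choice[s sP] : forall i, exists k, forall a t,
    sval a (i, t) -> (g a).1 = k.
  by exists s => a [i t]; exact: sP.
move=> i; have [e e01 eU] := unders_below_one D i.
have [a0 a0e _] := cut_arc e01 eU; exists (g a0).1 => a t at_.
have [v hv av] := arc_in_window e01 at_ erefl.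
apply: (@arc_walk _ _ D i e (fun _ b => (g b).1 = (g a0).1) a0) hv av => //.
move=> x u y p b c _ pu _ hb hc <-.
have [d dp] := arc_ex (over_not_underpass pu).
by rewrite (map_over phiM pu dp hb hc).
Qed.

(** One turn around a curve moves the second component by the total winding and
    comes back to the same arc. *)
Lemma map_monodromy (s : 'I_mu -> 'I_m) : quandle_map phi ->
  (forall a p, sval a p -> (g a).1 = s p.1) ->
  forall i, exists a t,
    sval a (i, t) /\ shift (total_winding D s i) (g a).2 = (g a).2.
Proof.
move=> phiM gs i; have [e e01 eU] := unders_below_one D i.
have [a0 a0e a0f] := cut_arc e01 eU; exists a0, (- e); split => //.
rewrite -(@winding_max _ _ _ D s i (1 - e)) //.
apply/esym; pose P t b :=
  [/\ (g b).1 = s i & (g b).2 = shift (winding D s i t) (g a0).2].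
suff [] : P (1 - e) a0 by [].
apply: (@arc_walk _ _ D i e P a0) a0f => //; last by lra.
- move=> x y a xy h [Pa1 Pa2]; split => //.
  rewrite (@winding_const _ _ _ D s i x) // => u uU.
  by apply: contra (h u uU) => /andP[-> /ltW].
- move=> x u y p a b /andP[xu uy] pu h ha hb [Pa1 Pa2].
  have [c cp] := arc_ex (over_not_underpass pu).
  rewrite /P (map_over phiM pu cp ha hb) /= Pa1 (gs _ _ cp) Pa2 shiftD.
  split => //.
  by rewrite addrC (winding_jump s pu _ h) // (ltW xu).
- split; first exact: gs a0e.
  rewrite winding_min ?shift0 // => u /unders_itv; lra.
Qed.

End Walk.

Let V := total_winding D (@id 'I_mu).
Let N := winding D (@id 'I_mu).

(** The value at a point is the winding vector since the base point, which is
    defined up to full turns. *)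
Definition model_point (p : lpoint R mu) : shift_quandle mu :=
  (p.1, cyclic_coset (V p.1) (N p.1 (frac p.2))).

(** The interval is open on the right: as [winding] counts the underpasses before
    a parameter strictly, the value at an underpass is that of the arc that
    arrives there. *)
Lemma model_point_itv i (x y : R) : x <= y ->
  (forall t, x <= t < y -> ~ underpass D (i, t)) ->
  model_point (i, x) = model_point (i, y).
Proof.
move=> xy h; rewrite /model_point /=; congr pair.
have hU (k : int) u : u \in unders D i -> ~ (x <= u + k%:~R < y).
  move=> uU hu; apply: (h _ hu); rewrite underpass_shift underpass_unders.
  by rewrite frac_id //; exact: unders_itv uU.
have := @frac_itv _ x; have := @frac_itv _ y.
have := Num.Theory.le_floor xy; rewrite le_eqVlt => /orP[/eqP e|e] fy fx.
  rewrite /N (@winding_const _ _ _ _ _ i (frac x)) //.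
    by rewrite /frac e lerD2r.
  move=> u uU; apply/negP => hu; apply: (hU (Num.floor x) u uU).
  by move: hu; rewrite /frac -e; lra.
(* When the interval contains an integer, the winding vector is complete at [x]
   and zero at [y], and these vectors define the same coset. *)
have e1 : (Num.floor x)%:~R + 1 <= (Num.floor y)%:~R :> R.
  by rewrite -(intrD _ _ 1) ler_int -ltzD1 // ltrD2r.
rewrite /N (@winding_max _ _ _ _ _ i (frac x)); last first.
  move=> u uU; have u01 := unders_itv uU; rewrite ltNge; apply/negP => xu.
  by apply: (hU (Num.floor x) u uU); move: xu fy; rewrite /frac; lra.
rewrite (@winding_min _ _ _ _ _ i (frac y)); last first.
  move=> u uU; have u01 := unders_itv uU; rewrite leNgt; apply/negP => yu.
  by apply: (hU (Num.floor y) u uU); move: yu fx; rewrite /frac; lra.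
by rewrite -[X in cyclic_coset _ X]add0r cyclic_cosetD.
Qed.

Lemma model_point_same p q : same_arc D p q -> model_point p = model_point q.
Proof.
case: p q => [i x] [j y] [/= <- [k h]].
have -> : model_point (i, x) = model_point (i, x + k%:~R).
  by rewrite /model_point /= fracDz.
have [xy|yx] := leP (x + k%:~R) y; last apply/esym; apply: model_point_itv.
- by [].
- by move=> t ht; apply: h; rewrite min_l ?max_r //; lra.
- exact: ltW.
- by move=> t ht; apply: h; rewrite min_r ?max_l ?(ltW yx) //; lra.
Qed.

Definition model_arc (a : arc D) : shift_quandle mu :=
  model_point (projT1 (cid (arc_inh a))).

Lemma model_arcE a p : sval a p -> model_arc a = model_point p.
Proof.
rewrite /model_arc; case: cid => q /= aq ap; apply: model_point_same.
by rewrite -(arc_mem_eq aq).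
Qed.

Lemma model_before q a : arc_before q a -> model_arc a = model_point q.
Proof.
case: q => i u /near_leftP[x /= xu h]; pose y := (x + u) / 2.
rewrite (@model_arcE a (i, y)); last by apply: h; rewrite /y; lra.
apply: model_point_itv => [|t ht]; first by rewrite /y; lra.
by apply: (@arc_not_underpass _ _ _ a); apply: h; move: ht; rewrite /y; lra.
Qed.

Lemma model_after p q b : over D p q -> arc_after q b ->
  model_arc b = (q.1, shift (turn D id (p, q)) (model_point q).2).
Proof.
case: q => i u pu /near_rightP[x /= ux h]; have [_ /= u01] := over_canonical pu.
pose y := (u + Num.min x 1) / 2.
have ym : u < Num.min x 1 by rewrite lt_min ux; lra.
have [mx m1] : Num.min x 1 <= x /\ Num.min x 1 <= 1.
  by rewrite !ge_min !lexx orbT.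
rewrite (@model_arcE b (i, y)); last by apply: h; rewrite /y; lra.
rewrite /model_point /= shift_coset frac_id; last by rewrite /y; lra.
rewrite (@frac_id _ u) // /N (winding_jump id (x := u) pu) //.
  by rewrite lexx /y; lra.
move=> v vU /andP[uv vy]; apply/eqP; rewrite eq_le uv andbT leNgt; apply/negP => uv'.
have : ~ underpass D (i, v).
  by apply: (@arc_not_underpass _ _ _ b); apply: h; move: vy; rewrite /y; lra.
by apply; rewrite underpass_unders frac_id // (unders_itv vU).
Qed.

Lemma model_map : exists2 phi : link_quandle D -> shift_quandle mu,
  quandle_map phi & forall a p, sval a p -> phi (link_gen a) = model_point p.
Proof.
have [|phi phiM phiE] :=
    @presented_lift _ (@link_relation R mu D) _ model_arc; last first.
  by exists phi => // a p ap; rewrite phiE; exact: model_arcE.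
move=> _ _ [p q a1 a2 a3 pq a1p]; rewrite /arc_on_right /arc_on_left /=.
have key a b : arc_before q a -> arc_after q b ->
  if 0 < writhe D p q then model_arc b = model_arc a ▷ model_arc a1
  else model_arc a = model_arc b ▷ model_arc a1.
  move=> ha hb; apply/(cross_shift _ _ _ (writhe_sign pq)).
  by rewrite (model_after pq hb) (model_before ha) (model_arcE a1p).
by case: ifP key => _ key ha hb; exact: key.
Qed.

End ToShift.

(** * Comparison of two links *)

Section Comparison.
Variables (R : realType) (mu : nat) (D : diagram R mu).

Lemma tc_arc_ind (P : tc_quotient (link_quandle D) -> Prop) :
  (forall a, P (tc_gen (link_gen a))) ->
  (forall x y, P x -> P y -> P (x ▷ y)) ->
  (forall x y, P (x ▷ y) -> P y -> P x) -> forall x, P x.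
Proof.
move=> Pgen Pop PopV; apply: presented_ind => // q; rewrite -/(tc_gen q).
move: q; apply: (@presented_ind _ _ (fun q => P (tc_gen q))) => // x y.
  by rewrite tc_gen_map; exact: Pop.
by rewrite tc_gen_map; exact: PopV.
Qed.

Lemma tc_model : exists2 h : tc_quotient (link_quandle D) -> shift_quandle mu,
  quandle_map h &
  (forall a p, sval a p -> (h (tc_gen (link_gen a))).1 = p.1) /\
  forall x, exists v, (h x).2 = cyclic_coset (total_winding D id (h x).1) v.
Proof.
have [phi phiM phiE] := model_map D.
have [|h hM hE] := tc_lift phiM; first by move=> p q s; exact: shift_op_comm.
exists h => //; split=> [a p ap|]; first by rewrite hE (phiE _ _ ap).
apply: tc_arc_ind => [a|x y [v e] _|x y + _].
- have [p ap] := arc_inh a; rewrite hE (phiE _ _ ap) /=; by eexists.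
- by exists (v + dir (h x).1 (h y).1); rewrite hM qop_shift /= e shift_coset.
- rewrite hM qop_shift /= => -[v e]; exists (v - dir (h x).1 (h y).1).
  by rewrite -shift_coset -e shiftD addNr shift0.
Qed.

Lemma arc_on i : exists (a : arc D) t, sval a (i, t).
Proof.
have [e e01 eU] := unders_below_one D i.
by have [a ae _] := cut_arc e01 eU; exists a, (- e).
Qed.

End Comparison.

(** The composite of [f] with the model of [D'] is subject to [map_monodromy],
    and the invariant set is then a coset of the multiples of
    [total_winding D' id (s i)], so that the vector that fixes it is a multiple. *)
Lemma tc_map_linking (R : realType) (mu mu' : nat)
    (D : diagram R mu) (D' : diagram R mu')
    (f : tc_quotient (link_quandle D) -> tc_quotient (link_quandle D'))
    (h : tc_quotient (link_quandle D) -> shift_quandle mu)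
    (h' : tc_quotient (link_quandle D') -> shift_quandle mu') :
  quandle_map f -> quandle_map h -> quandle_map h' ->
  (forall a p, sval a p -> (h (tc_gen (link_gen a))).1 = p.1) ->
  (forall x, exists v,
     (h' x).2 = cyclic_coset (total_winding D' id (h' x).1) v) ->
  exists s : 'I_mu -> 'I_mu', (forall x, (h' (f x)).1 = s (h x).1) /\
    forall i, exists k : int,
      total_winding D s i = total_winding D' id (s i) *~ k.
Proof.
move=> fM hM h'M hE h'V.
pose phi q := h' (f (tc_gen q)).
have phiM : quandle_map phi by move=> x y; rewrite /phi tc_gen_map fM h'M.
have [s sE] := map_component phiM; exists s; split.
  apply: tc_arc_ind => [a|x y e _|x y + _]; last 2 first.
  - by rewrite fM h'M hM !qop_shift.
  - by rewrite fM h'M hM !qop_shift.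
  by have [p ap] := arc_inh a; rewrite (hE _ _ ap) -(sE _ _ ap).
move=> i; have [a [t [ait e]]] := map_monodromy phiM sE i.
have [v hv] := h'V (f (tc_gen (link_gen a))).
rewrite -/(phi _) (sE _ _ ait) /= in hv.
by move: e; rewrite hv => /cyclic_coset_inv.
Qed.

(** Unless both families vanish, [k' * k = 1], so that [k] is a sign. *)
Lemma int_mutual_multiple (I : Type) (P : I -> Prop) (u v : I -> int)
    (k k' : int) :
  (forall i, P i -> u i = v i * k) -> (forall i, P i -> v i = u i * k') ->
  exists2 eps : int, eps = 1 \/ eps = -1 & forall i, P i -> u i = eps * v i.
Proof.
move=> uv vu.
have [[i [Pi ui]]|u0] := pselect (exists i, P i /\ u i != 0); last first.
  exists 1; first by left.
  move=> i Pi; suff ui : u i = 0 by rewrite (vu i Pi) ui mul0r mulr0.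
  by apply: contrapT => /eqP ui; apply: u0; exists i.
exists k; last by move=> j /uv ->; rewrite mulrC.
have : k' * k = 1 by apply: (mulfI ui); rewrite mulrA -vu // -uv // mulr1.
move=> kk; have : k \is a GRing.unit by apply/unitrPr; exists k'; rewrite mulrC.
by rewrite unitrE; case: k {uv} kk => [[|[|n]]|[|n]] _ //=; auto.
Qed.

Theorem corollary7 (R : realType)
    (Qt : forall mu : nat, diagram R mu -> quandleType)
    (Qt_invariant : forall (mu : nat) (D D' : diagram R mu),
       link_equiv D D' -> quandle_iso (Qt mu D) (Qt mu D'))
    (Qt_tc : forall (mu : nat) (D : diagram R mu),
       quandle_iso (tc_quotient (Qt mu D)) (tc_quotient (link_quandle D)))
    (mu mu' : nat) (D : diagram R mu) (D' : diagram R mu')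
    (Qt_iso : quandle_iso (Qt mu D) (Qt mu' D')) :
  mu = mu' /\
  exists (s : 'I_mu -> 'I_mu') (eps : 'I_mu -> int),
    [/\ bijective s,
        forall i, eps i = 1 \/ eps i = -1 &
        forall i j, i != j ->
          linking_over D j i = eps i * linking_over D' (s j) (s i)].
Proof.
have [f fM [g fK gK]] :
    quandle_iso (tc_quotient (link_quandle D)) (tc_quotient (link_quandle D')).
  apply: quandle_iso_trans (quandle_iso_sym (Qt_tc mu D)) _.
  exact: quandle_iso_trans (tc_quotient_iso Qt_iso) (Qt_tc mu' D').
have gM : quandle_map g.
  by move=> x y; rewrite -{1}(gK x) -{1}(gK y) -fM fK.
have [h hM [hE hV]] := tc_model D.
have [h' h'M [h'E h'V]] := tc_model D'.
have [s [sE sV]] := tc_map_linking fM hM h'M hE h'V.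
have [s' [s'E s'V]] := tc_map_linking gM h'M hM h'E hV.
have sK : cancel s s'.
  move=> i; have [a [t ait]] := arc_on D i.
  have := s'E (f (tc_gen (link_gen a))); rewrite fK sE (hE _ _ ait).
  exact: esym.
have s'K : cancel s' s.
  move=> i; have [a [t ait]] := arc_on D' i.
  have := sE (g (tc_gen (link_gen a))); rewrite gK s'E (h'E _ _ ait).
  exact: esym.
have sB : bijective s by exists s'.
split; first by have := bij_eq_card sB; rewrite !card_ord.
have : forall i, exists eps : int, (eps = 1 \/ eps = -1) /\
    forall j, i != j -> linking_over D j i = eps * linking_over D' (s j) (s i).
  move=> i; have [k ki] := sV i; have [k' ki'] := s'V (s i); rewrite sK in ki'.
  have sI := can_inj sK; have s'I := can_inj s'K.
  have [||eps eps1 epsE] := @int_mutual_multiple 'I_mu (fun j => i != j)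
      (fun j => linking_over D j i) (fun j => linking_over D' (s j) (s i)) k k'.
  - move=> j ij; rewrite -(total_winding_linking D sI ij) ki ffunMzE -mulrzr intz.
    by rewrite -(total_winding_linking D' (s := id)) ?(inj_eq sI).
  - move=> j ij; rewrite -(total_winding_linking D' s'I) ?(inj_eq sI) // sK ki'.
    by rewrite ffunMzE -mulrzr intz -(total_winding_linking D (s := id)).
  by exists eps.
move=> /boolp.choice[eps epsP]; exists s, eps; split => // [i|i j ij].
  by have [] := epsP i.
by have [_] := epsP i; apply.
Qed.
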